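(* For every infinite, connected, simple, undirected graph $G$ with all degrees finite, there exists a rotor mechanism on $G$ that admits a recurrent rotor configuration.
   Context: A rotor mechanism on $G$ assigns to each vertex a fixed cyclic order of its neighbours (a single cycle through all neighbours). A rotor configuration assigns to each vertex one of its neighbours (the vertex its rotor points to). Given a rotor mechanism, an initial rotor configuration and a starting vertex for a particle, the rotor walk evolves in discrete time: at each step the rotor at the particle's current location is first incremented to point to the next neighbour in the cyclic order, and then the particle moves to this new neighbour. The rotor walk is recurrent if it visits every vertex infinitely many times. A rotor configuration is called recurrent if the rotor walk with it as initial configuration is recurrent for every starting vertex (on an infinite connected graph with all degrees finite, this is equivalent to recurrence for some starting vertex). *)

(* Defs.v *)
From mathcomp Require Import all_boot.
From mathcomp Require Import boolp classical_sets functions cardinality.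

Set Implicit Arguments.
Unset Strict Implicit.
Unset Printing Implicit Defensive.

Local Open Scope classical_set_scope.

Definition connected_graph (V : eqType) (adj : rel V) : Prop :=
  forall x y : V, exists2 p : seq V, path adj x p & last x p = y.

Definition locally_finite (V : eqType) (adj : rel V) : Prop :=
  forall v : V, finite_set [set w | adj v w].

(* The cyclic order at v is the duplicate-free sequence m v of all the
   neighbours of v, read cyclically: the neighbour following w is
   next (m v) w. *)
Definition rotor_mechanism (V : eqType) (adj : rel V) (m : V -> seq V) : Prop :=
  forall v : V, uniq (m v) /\ (forall w : V, (w \in m v) = adj v w).

Definition rotor_configuration (V : eqType) (adj : rel V) (rho : V -> V) :
    Prop :=
  forall v : V, adj v (rho v).

(* A state is a pair (current rotor configuration, position of the particle). *)
Definition rotor_step (V : eqType) (m : V -> seq V) (s : (V -> V) * V) :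
    (V -> V) * V :=
  let: (rho, x) := s in
  let y := next (m x) (rho x) in
  (fun v => if v == x then y else rho v, y).

Definition rotor_walk (V : eqType) (m : V -> seq V) (rho : V -> V) (x : V)
    (n : nat) : V :=
  (iter n (rotor_step m) (rho, x)).2.

Definition recurrent_walk (V : eqType) (m : V -> seq V) (rho : V -> V) (x : V) :
    Prop :=
  forall v : V, infinite_set [set n | rotor_walk m rho x n = v].

Definition recurrent_configuration (V : eqType) (m : V -> seq V)
    (rho : V -> V) : Prop :=
  forall x : V, recurrent_walk m rho x.

(* Main.v *)
(** Grade the vertices by their distance d to a root; let the rotor at v serve
    the neighbours closer to the root first, and start it so that its first move
    is the first of these.  For each n, let v be fired (n - d v) full turns plus
    once towards each closer neighbour if d v <= n, and never otherwise.  Under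
    this finitely supported firing count every vertex is entered exactly as often
    as it is left.  By the least action argument, a rotor walk from x can exceed
    such a balanced count for the first time only by leaving x; since it must
    exceed it eventually, x is left at least n - d x times.  So x is visited
    infinitely often, and hence so is each neighbour of a vertex visited
    infinitely often. *)

Require Import Defs.
From mathcomp Require Import all_boot.
From mathcomp Require Import boolp classical_sets functions cardinality.
From mathcomp Require Import zify.

Set Implicit Arguments.
Unset Strict Implicit.
Unset Printing Implicit Defensive.

Local Open Scope classical_set_scope.

(** * Cyclic reading of duplicate-free sequences *)

Lemma next_nth_uniq (T : eqType) (s : seq T) (x0 : T) (j : nat) :
  uniq s -> j < size s -> next s (nth x0 s j) = nth x0 s (j.+1 %% size s).
Proof.
move=> s_uniq js; rewrite next_nth mem_nth // index_uniq //.
case: s s_uniq js => //= y s _; rewrite ltnS leq_eqVlt => /orP[/eqP ->|js].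
  (* At the last index [next] reads past the end of the tail and returns its default there, the head
     [y]. *)
  by rewrite modnn nth_default.
by rewrite modn_small //=; apply: set_nth_default.
Qed.

(** A rotor is incremented before it is followed, so one that starts at the last entry serves [s]
    from its head on. *)
Lemma iter_next_last (T : eqType) (s : seq T) (x0 : T) (i : nat) :
  uniq s -> 0 < size s ->
  iter i.+1 (next s) (last x0 s) = nth x0 s (i %% size s).
Proof.
move=> s_uniq s_gt0; elim: i => [|i IHi].
  rewrite /= -nth_last next_nth_uniq ?prednK //.
  by rewrite modnn mod0n.
rewrite iterS IHi next_nth_uniq ?ltn_pmod //.
by rewrite -addn1 modnDml addn1.
Qed.

Lemma sum_eq_take (T : eqType) (s : seq T) (x0 w : T) (k : nat) :
  uniq s -> k <= size s ->
  \sum_(i < k) (nth x0 s i == w) = (w \in take k s).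
Proof.
move=> s_uniq ks; rewrite -count_uniq_mem ?take_uniq // -sum1_count.
rewrite (big_nth x0) size_take_min (minn_idPl ks) big_mkord.
rewrite [RHS]big_mkcond; apply: eq_bigr => i _.
by rewrite nth_take //=; case: eqP.
Qed.

Lemma sum_eq_modn (T : eqType) (s : seq T) (x0 w : T) (q k : nat) :
  uniq s -> k <= size s ->
  \sum_(i < q * size s + k) (nth x0 s (i %% size s) == w) =
    q * (w \in s) + (w \in take k s).
Proof.
move=> s_uniq ks.
have small j : j <= size s ->
    \sum_(i < j) (nth x0 s (i %% size s) == w) = (w \in take j s).
  move=> js; rewrite -(@sum_eq_take _ s x0) //; apply: eq_bigr => i _.
  by rewrite modn_small // (leq_trans (ltn_ord i)).
elim: q => [|q IHq]; first by rewrite !mul0n !add0n small.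
rewrite mulSn -addnA big_split_ord /= small // take_size mulSn -addnA -IHq.
by congr (_ + _); apply: eq_bigr => i _; rewrite modnDl.
Qed.

(** * Firing counts of a rotor walk *)

Section Walk.

Variables (V : eqType) (m : V -> seq V) (rho : V -> V).

Definition sent_to (v : V) (i : nat) : V := iter i.+1 (next (m v)) (rho v).

(** The targets of the exits from [v] depend only on how many there were, not on the rest of the
    walk. Hence this is a function of a bare count, which need not come from any walk. *)
Definition sent (v w : V) (c : nat) : nat := \sum_(i < c) (sent_to v i == w).

Lemma leq_sent (v w : V) (c c' : nat) : c <= c' -> sent v w c <= sent v w c'.
Proof. by move=> cc'; rewrite /sent -(subnKC cc') big_split_ord leq_addr. Qed.

Definition fired (x v : V) (t : nat) : nat :=
  \sum_(s < t) (rotor_walk m rho x s == v).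

Lemma firedS (x v : V) (t : nat) :
  fired x v t.+1 = fired x v t + (rotor_walk m rho x t == v).
Proof. exact: big_ord_recr. Qed.

Lemma rotor_config_fired (x v : V) (t : nat) :
  (iter t (rotor_step m) (rho, x)).1 v =
  iter (fired x v t) (next (m v)) (rho v).
Proof.
elim: t v => [|t IHt] v; first by rewrite /fired big_ord0.
rewrite firedS /rotor_walk iterS.
case: (iter t _ _) IHt => rho' y /= IHt.
rewrite eq_sym; case: (y =P v) => [->|_]; last by rewrite addn0 IHt.
by rewrite addn1 IHt.
Qed.

Lemma rotor_walkS (x : V) (t : nat) :
  let y := rotor_walk m rho x t in
  rotor_walk m rho x t.+1 = sent_to y (fired x y t).
Proof.
rewrite /= /sent_to iterS -rotor_config_fired /rotor_walk iterS.
by case: (iter t _ _).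
Qed.

Lemma sum_fired (x : V) (S : seq V) (t : nat) : uniq S ->
  (forall s, s < t -> rotor_walk m rho x s \in S) ->
  \sum_(v <- S) fired x v t = t.
Proof.
move=> S_uniq inS; rewrite exchange_big /= -[RHS]card_ord -sum1_card.
apply: eq_bigr => i _; transitivity (\sum_(j <- S | j == rotor_walk m rho x i) 1).
  by rewrite [RHS]big_mkcond; apply: eq_bigr => j _; rewrite eq_sym; case: eqP.
by rewrite sum1_count count_uniq_mem // inS.
Qed.

Lemma fired_unbounded (x v : V) :
  (forall k, exists t, k <= fired x v t) ->
  infinite_set [set n | rotor_walk m rho x n = v].
Proof.
move=> unb /finite_seqP[s sE]; have [t] := unb (size s).+1.
apply/negP; rewrite -leqNgt.
have -> : fired x v t = size [seq i <- iota 0 t | rotor_walk m rho x i == v].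
  rewrite size_filter /fired -sum1_count [RHS]big_mkcond /= -[t in RHS]subn0.
  by rewrite -/(index_iota 0 t) big_mkord; apply: eq_bigr => i _; case: eqP.
apply: uniq_leq_size.
  by rewrite filter_uniq ?iota_uniq.
move=> i; rewrite mem_filter => /andP[/eqP iv _].
by have : [set` s] i by rewrite -sE.
Qed.

End Walk.

(** * Conservation of the particle and the least action argument *)

Section Conservation.

Variables (V : eqType) (adj : rel V) (m : V -> seq V) (rho : V -> V).
Hypotheses (adj_sym : symmetric adj) (m_mech : rotor_mechanism adj m).
Hypothesis rho_conf : rotor_configuration adj rho.

Lemma adj_sent_to (v : V) (i : nat) : adj v (sent_to m rho v i).
Proof.
have [_ mE] := m_mech v; rewrite -mE /sent_to.
by elim: i => [|i IHi]; rewrite iterS mem_next // mE.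
Qed.

(* Entries plus the initial presence equal exits plus the current presence. *)
Lemma fired_conservation (x y : V) (t : nat) :
  \sum_(u <- m y) sent m rho u y (fired m rho x u t) + (x == y) =
  fired m rho x y t + (rotor_walk m rho x t == y).
Proof.
elim: t => [|t IHt].
  rewrite /fired big_ord0 big1 // => u _.
  by rewrite big_ord0 /sent big_ord0.
rewrite firedS -IHt rotor_walkS /=.
set z := rotor_walk m rho x t; set z' := sent_to m rho z _.
rewrite -[RHS]addnA [_ + (z' == y)]addnC addnA; congr (_ + _).
have [my_uniq myE] := m_mech y.
(* A move into [y] comes from [z] alone, and [z] occurs exactly once in [m y] by symmetry of
   [adj]. *)
have -> : (z' == y) = \sum_(u <- m y) ((z == u) && (z' == y)) :> nat.
  case: (z' =P y) => [z'y|_]; last by rewrite big1 // => u _; rewrite andbF.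
  transitivity (\sum_(u <- m y | u == z) 1).
    rewrite sum1_count count_uniq_mem // myE adj_sym -z'y.
    by rewrite adj_sent_to.
  by rewrite big_mkcond; apply: eq_bigr => u _; rewrite eq_sym andbT; case: eqP.
rewrite -big_split; apply: eq_bigr => u _ /=.
rewrite firedS -/z; case: (z =P u) => [<-|_]; last by rewrite !addn0.
by rewrite addn1 /sent big_ord_recr.
Qed.

(** If the exits from [x] stayed below [f x], all firing counts would stay below [f] forever. The
    walk would then be confined to [S] and its length bounded by the sum of [f]. *)
Lemma balanced_leq_fired (x : V) (f : V -> nat) (S : seq V) :
  (forall v, 0 < f v -> v \in S) ->
  (forall v, \sum_(u <- m v) sent m rho u v (f u) = f v) ->
  exists t, f x <= fired m rho x x t.
Proof.
move=> fS f_bal; apply: contrapT => not_fired.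
have fired_x t : fired m rho x x t < f x.
  by rewrite ltnNge; apply/negP => le_f; apply: not_fired; exists t.
have step t : (forall v, fired m rho x v t <= f v) ->
    fired m rho x (rotor_walk m rho x t) t < f (rotor_walk m rho x t).
  set z := rotor_walk _ _ _ _ => le_f; have [<-|xz] := eqVneq x z.
    exact: fired_x.
  (* If z had already been fired f z times, it would have been entered f z + 1
     times, which is more than the balanced count f allows. *)
  have := fired_conservation x z t.
  rewrite eqxx (negPf xz) addn0 addn1 => <-; rewrite -f_bal.
  by apply: leq_sum => u _; apply: leq_sent.
have le_f t v : fired m rho x v t <= f v.
  elim: t v => [|t IHt] v; first by rewrite /fired big_ord0.
  rewrite firedS; have := step t IHt.
  by case: eqP => [->|_ _]; rewrite ?addn1 ?addn0.
(* After [F.+1] steps inside [S] the counts add up to [F.+1], but each is bounded by [f]. *)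
pose F := \sum_(v <- undup S) f v.
have inS s : rotor_walk m rho x s \in undup S.
  by rewrite mem_undup; apply: fS; apply: leq_trans (step s (le_f s)).
have := @sum_fired _ m rho x (undup S) F.+1 (undup_uniq S) (fun s _ => inS s).
apply/eqP; rewrite neq_ltn ltnS; apply/orP; left.
by apply: leq_sum.
Qed.

Lemma sent_last (v w : V) (q k : nat) :
  rho v = last v (m v) -> k <= size (m v) ->
  sent m rho v w (q * size (m v) + k) = q * adj v w + (w \in take k (m v)).
Proof.
have [mv_uniq mE] := m_mech v => rho_last km.
rewrite -mE -(@sum_eq_modn _ _ v) //; apply: eq_bigr => i _.
rewrite /sent_to rho_last iter_next_last //.
by move: (rho_conf v); rewrite -mE; case: (m v).
Qed.

Lemma fired_unbounded_adj (x v w : V) :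
  rho v = last v (m v) -> adj v w ->
  (forall k, exists t, k <= fired m rho x v t) ->
  forall k, exists t, k <= fired m rho x w t.
Proof.
(* One turn more than [k], because the particle may have entered [w] without having left it yet. *)
move=> rho_last vw unb k; have [t le_t] := unb (k.+1 * size (m v)).
exists t; have := fired_conservation x w t.
have v_mw : v \in m w by have [_ ->] := m_mech w; rewrite adj_sym.
rewrite (big_rem v v_mw) /=; have := leq_sent m rho v w le_t.
rewrite -[_ * _]addn0 sent_last // vw take0 in_nil /=.
by case: eqP => _; case: eqP => _; lia.
Qed.

End Conservation.

(** * The graded mechanism and its balanced odometers *)

Section Levels.

Variables (V : eqType) (adj : rel V) (d : V -> nat) (nbr : V -> seq V).
Hypothesis adj_sym : symmetric adj.
Hypothesis d_lip : forall v w, adj v w -> d w <= (d v).+1.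
Hypothesis nbr_mech : rotor_mechanism adj nbr.
Hypothesis nbr_neq0 : forall v, exists w, adj v w.

Definition down (v : V) : seq V := [seq w <- nbr v | d w < d v].

Definition level_mech (v : V) : seq V :=
  down v ++ [seq w <- nbr v | ~~ (d w < d v)].

Definition level_config (v : V) : V := last v (level_mech v).

Lemma level_mechP : rotor_mechanism adj level_mech.
Proof.
move=> v; have [nbr_uniq nbrE] := nbr_mech v.
have P : perm_eq (level_mech v) (nbr v) by rewrite perm_filterC.
by split=> [|w]; rewrite ?(perm_uniq P) // (perm_mem P).
Qed.

Lemma size_level_mech_gt0 (v : V) : 0 < size (level_mech v).
Proof.
have [w] := nbr_neq0 v; have [_ <-] := level_mechP v.
by case: (level_mech v).
Qed.

Lemma level_configP : rotor_configuration adj level_config.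
Proof.
move=> v; have [_ <-] := level_mechP v; have := size_level_mech_gt0 v.
by rewrite /level_config; case: (level_mech v) => //= w s _; apply: mem_last.
Qed.

Definition odometer (n : nat) (v : V) : nat :=
  if d v <= n then (n - d v) * size (level_mech v) + size (down v) else 0.

Lemma sent_odometer (n : nat) (v w : V) : adj v w ->
  sent level_mech level_config v w (odometer n v) =
  if d v <= n then n - d v + (d w < d v) else 0.
Proof.
move=> vw; rewrite /odometer; case: ifP => _; last by rewrite /sent big_ord0.
rewrite (sent_last level_mechP level_configP) //; last first.
  by rewrite size_cat leq_addr.
have [_ nbrE] := nbr_mech v.
by rewrite take_size_cat // mem_filter nbrE vw muln1 andbT.
Qed.

(** Levels of neighbours differ by at most one, so every edge is crossed equally often in both
    directions: what [u] sends to [v] equals what [v] sends to [u]. Summing the latter over the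
    neighbours gives all exits from [v]. *)
Lemma odometer_balanced (n : nat) (v : V) :
  \sum_(u <- level_mech v) sent level_mech level_config u v (odometer n u) =
  odometer n v.
Proof.
have [_ mE] := level_mechP v.
have sizeE : size (down v) = \sum_(u <- level_mech v) (d u < d v).
  rewrite big_cat /= [X in _ + X]big1_seq ?addn0.
    rewrite -sum1_size !big_filter.
    by apply: eq_bigr => u ->.
  by move=> u; rewrite mem_filter => /andP[_ /andP[/negPf-> _]].
transitivity (\sum_(u <- level_mech v)
    (if d v <= n then n - d v + (d u < d v) else 0)).
  apply: eq_big_seq => u; rewrite mE => vu; have uv : adj u v by rewrite adj_sym.
  rewrite sent_odometer //; move: (d_lip vu) (d_lip uv).
  by case: (leqP (d u) n); case: (leqP (d v) n); lia.
rewrite /odometer; case: ifP => _; last exact: big1.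
by rewrite big_split /= -sizeE big_const_seq count_predT iter_addn_0.
Qed.

Lemma level_config_recurrent :
  connected_graph adj ->
  (forall n, exists S : seq V, forall v, d v <= n -> v \in S) ->
  recurrent_configuration level_mech level_config.
Proof.
move=> conn ball_fin x v; apply: fired_unbounded.
have unb_x k : exists t, k <= fired level_mech level_config x x t.
  (* With [n = d x + k] the odometer prescribes [k] full turns at [x], hence at least [k] exits. *)
  have [S inS] := ball_fin (d x + k).
  have [||t le_t] := @balanced_leq_fired _ _ _ _ adj_sym level_mechP
    level_configP x (odometer (d x + k)) S.
  - by move=> w; rewrite /odometer; case: ifP => // /inS.
  - exact: odometer_balanced.
  exists t; apply: leq_trans le_t; rewrite /odometer leq_addr addKn.
  by rewrite -[k in k <= _]addn0 leq_add // leq_pmulr // size_level_mech_gt0.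
have [p] := conn x v.
(* The walk keeps its start [x]; only the vertex known to be fired unboundedly often moves along the
   path. *)
elim: p {2 3 4}x unb_x => [|w p IHp] y unb /=; first by move=> _ <-.
move=> /andP[yw pw]; apply: IHp pw.
exact: (fired_unbounded_adj adj_sym level_mechP level_configP) unb.
Qed.

End Levels.

(** * The distance grading and the conclusion *)

(** The list [B n] is the ball of radius [n] around [o], and [d v] is the least radius whose ball
    contains [v], which exists by connectedness. *)
Lemma exists_levels (V : eqType) (adj : rel V) (nbr : V -> seq V) (o : V) :
  rotor_mechanism adj nbr -> connected_graph adj ->
  exists2 d : V -> nat, (forall v w, adj v w -> d w <= (d v).+1) &
    forall n, exists S : seq V, forall v, d v <= n -> v \in S.
Proof.
move=> nbr_mech conn.
pose B := fix B n := if n is n'.+1 then B n' ++ flatten (map nbr (B n'))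
                     else [:: o].
have B_adj n v w : v \in B n -> adj v w -> w \in B n.+1.
  move=> vB vw; rewrite /= mem_cat; apply/orP; right.
  by apply/flatten_mapP; exists v => //; have [_ ->] := nbr_mech v.
have B_mono n n' v : n <= n' -> v \in B n -> v \in B n'.
  move=> /subnKC <-; elim: (n' - n) => [|j IHj] vB; first by rewrite addn0.
  by rewrite addnS /= mem_cat IHj.
have B_path p u n : u \in B n -> path adj u p -> exists k, last u p \in B k.
  elim: p u n => [|w p IHp] u n uB /=; first by exists n.
  by move=> /andP[uw]; apply: IHp (B_adj _ _ _ uB uw).
have B_cover v : exists n, v \in B n.
  have [p op <-] := conn o v.
  by apply: (B_path p o 0) op; rewrite mem_seq1.
exists (fun v => ex_minn (B_cover v)) => [v w vw|n].
  case: ex_minnP => n wB n_min; case: ex_minnP => k vB _.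
  exact: n_min (B_adj _ _ _ vB vw).
by exists (B n) => v; case: ex_minnP => k vB _ /B_mono; apply.
Qed.

Theorem theorem4 (V : eqType) (adj : rel V)
    (adj_sym : symmetric adj) (adj_irr : irreflexive adj)
    (V_infinite : infinite_set [set: V])
    (adj_connected : connected_graph adj)
    (adj_locally_finite : locally_finite adj) :
  exists m : V -> seq V, rotor_mechanism adj m /\
    exists rho : V -> V,
      rotor_configuration adj rho /\ recurrent_configuration m rho.
Proof.
have [nbr nbr_mech] : {nbr : V -> seq V & rotor_mechanism adj nbr}.
  apply: (@choice _ _ (fun v s => uniq s /\ forall w, (w \in s) = adj v w)) => v.
  have /finite_seqP[s sE] := adj_locally_finite v.
  exists (undup s); split=> [|w]; first exact: undup_uniq.
  by rewrite mem_undup; apply/idP/idP; [change ([set` s] w -> adj v w)|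
    change (adj v w -> [set` s] w)]; rewrite -sE.
have [o _] : [set: V] !=set0.
  apply: contrapT => /nonemptyPn V0; apply: V_infinite.
  by rewrite V0; apply: finite_set0.
(* A vertex without neighbours would, by connectedness, be the whole graph, which is infinite. *)
have nbr_neq0 v : exists w, adj v w.
  apply: contrapT => no_nbr; apply: V_infinite.
  apply/finite_seqP; exists [:: v]; apply/seteqP; split=> // w _ /=.
  rewrite mem_seq1; have [[|u p] /= + <-//] := adj_connected v w.
  by move=> /andP[vu _]; case: no_nbr; exists u.
have [d d_lip ball_fin] := exists_levels o nbr_mech adj_connected.
exists (level_mech d nbr); split; first exact: level_mechP.
exists (level_config d nbr); split; first exact: level_configP.
exact: level_config_recurrent adj_connected ball_fin.
Qed.
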